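(* Let $(X,\mathcal{A})$ be a measurable space, let $\mu\colon\mathcal{A}\to[0,\infty]$ be a nonadditive measure, and let $0<p<\infty$ and $0<q<\infty$. Let $\mathcal{T}$ be the Sugeno-Lorentz topology on $\mathfrak{Su}(\mu)$ generated by $(\,\cdot\,)_{p,q}$. (1) The following conditions are equivalent: (i) $\mu$ is autocontinuous from above. (ii) For every $f\in\mathfrak{Su}(\mu)$ and $r>0$ the sphere $S(f,r)$ is open with respect to $\mathcal{T}$. Furthermore, if $\mu$ is autocontinuous from above, then $\mathcal{U}(f)$ is the neighborhood system of $f$ (with respect to $\mathcal{T}$) for every $f\in\mathfrak{Su}(\mu)$, and the topology $\mathcal{T}$ is first countable. (2) The following conditions are equivalent: (i) $\mu$ is autocontinuous from below. (ii) For every $f\in\mathfrak{Su}(\mu)$ and $r>0$, the set $\{g\in\mathfrak{Su}(\mu)\colon (f-g)_{p,q}\le r\}$ is closed with respect to $\mathcal{T}$.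
   Context: $(X,\mathcal{A})$ is a measurable space ($X$ nonempty, $\mathcal{A}$ a $\sigma$-field of subsets of $X$) and $\mathcal{F}_0(X)$ is the set of all $\mathcal{A}$-measurable real-valued functions on $X$. A nonadditive measure is a set function $\mu\colon\mathcal{A}\to[0,\infty]$ with $\mu(\emptyset)=0$ and $\mu(A)\le\mu(B)$ whenever $A,B\in\mathcal{A}$, $A\subset B$. It is autocontinuous from above if $\mu(A\cup B_n)\to\mu(A)$ whenever $A,B_n\in\mathcal{A}$ ($n\in\mathbb{N}$) and $\mu(B_n)\to0$; autocontinuous from below if $\mu(A\setminus B_n)\to\mu(A)$ whenever $A,B_n\in\mathcal{A}$ and $\mu(B_n)\to0$. For $r>0$, $\mu^{r}$ is the nonadditive measure $A\mapsto\mu(A)^{r}$. The Sugeno integral of an $\mathcal{A}$-measurable $f\colon X\to[0,\infty)$ is $\mathrm{Su}(\mu,f):=\sup_{t\in[0,\infty)}\min\{t,\mu(\{x\in X\colon f(x)>t\})\}$. The Sugeno-Lorentz prenorm is $(f)_{p,q}:=\mathrm{Su}(\mu^{q/p},\,p|f|^q/q)^{1/q}\in[0,\infty]$ for $f\in\mathcal{F}_0(X)$, and $\mathfrak{Su}(\mu):=\{f\in\mathcal{F}_0(X)\colon\mathrm{Su}(\mu,|f|)<\infty\}=\{f\in\mathcal{F}_0(X)\colon (f)_{p,q}<\infty\}$. Sugeno-Lorentz topology: for $f\in\mathfrak{Su}(\mu)$ and $r>0$ let $S(f,r):=\{g\in\mathfrak{Su}(\mu)\colon (f-g)_{p,q}<r\}$;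 let $\mathcal{U}(f)$ be the collection of all $U\subset\mathfrak{Su}(\mu)$ such that $S(f,r)\subset U$ for some $r>0$; and let $\mathcal{T}$ be the collection of all $G\subset\mathfrak{Su}(\mu)$ such that $G\in\mathcal{U}(f)$ for every $f\in G$. $\mathcal{T}$ is a topology on $\mathfrak{Su}(\mu)$. Neighborhoods of a point are not required to be open (a neighborhood of $f$ is a set containing an open set containing $f$). *)

(* Defs.v *)
From HB Require Import structures.
From mathcomp Require Import all_boot all_order all_algebra.
From mathcomp Require Import all_classical all_reals all_analysis.
From mathcomp Require Import measurable_realfun.

Set Implicit Arguments.
Unset Strict Implicit.
Unset Printing Implicit Defensive.

Import Order.TTheory GRing.Theory Num.Theory.
Import numFieldNormedType.Exports.

Local Open Scope classical_set_scope.
Local Open Scope ring_scope.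

(* Set functions are total on [set X]; every notion below only looks at their
   values on measurable sets. *)
Definition nonadditive_measure (d : measure_display) (X : measurableType d)
    (R : realType) (mu : set X -> \bar R) : Prop :=
  [/\ forall A, measurable A -> (0 <= mu A)%E,
      mu set0 = 0%E &
      forall A B, measurable A -> measurable B -> A `<=` B ->
        (mu A <= mu B)%E].

Definition autocontinuous_from_above (d : measure_display)
    (X : measurableType d) (R : realType) (mu : set X -> \bar R) : Prop :=
  forall (A : set X) (B : (set X)^nat), measurable A ->
    (forall n, measurable (B n)) ->
    mu (B n) @[n --> \oo] --> 0%E ->
    mu (A `|` B n) @[n --> \oo] --> mu A.

Definition autocontinuous_from_below (d : measure_display)
    (X : measurableType d) (R : realType) (mu : set X -> \bar R) : Prop :=
  forall (A : set X) (B : (set X)^nat), measurable A ->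
    (forall n, measurable (B n)) ->
    mu (B n) @[n --> \oo] --> 0%E ->
    mu (A `\` B n) @[n --> \oo] --> mu A.

Definition Sugeno (X : Type) (R : realType) (mu : set X -> \bar R)
    (f : X -> R) : \bar R :=
  ereal_sup [set Order.min t%:E (mu [set x | t < f x]) | t in [set t | 0 <= t]].

Definition SL_prenorm (d : measure_display) (X : measurableType d)
    (R : realType) (mu : set X -> \bar R) (p q : R) (f : {mfun X >-> R}) :
    \bar R :=
  (Sugeno (fun A => mu A `^ (q / p)) (fun x => p * (`|f x| `^ q) / q)%R
     `^ q^-1)%E.

(* The carrier depends on [mu] only; [p] and [q] are phantom parameters, needed
   because the topology is attached to the type. *)
Definition SL_space (d : measure_display) (X : measurableType d)
    (R : realType) (mu : set X -> \bar R) (p q : R) : Type :=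
  {f : {mfun X >-> R} | (Sugeno mu (fun x => `|f x|%R) < +oo)%E}.

HB.instance Definition _ (d : measure_display) (X : measurableType d)
    (R : realType) (mu : set X -> \bar R) (p q : R) :=
  Choice.on (SL_space mu p q).

Definition SL_sphere (d : measure_display) (X : measurableType d)
    (R : realType) (mu : set X -> \bar R) (p q : R)
    (f : SL_space mu p q) (r : R) : set (SL_space mu p q) :=
  [set g | (SL_prenorm mu p q (val f - val g)%R < r%:E)%E].

Definition SL_closed_sphere (d : measure_display) (X : measurableType d)
    (R : realType) (mu : set X -> \bar R) (p q : R)
    (f : SL_space mu p q) (r : R) : set (SL_space mu p q) :=
  [set g | (SL_prenorm mu p q (val f - val g)%R <= r%:E)%E].

Definition SL_U (d : measure_display) (X : measurableType d)
    (R : realType) (mu : set X -> \bar R) (p q : R)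
    (f : SL_space mu p q) : set_system (SL_space mu p q) :=
  [set U | exists2 r : R, 0 < r & SL_sphere f r `<=` U].

Definition SL_open (d : measure_display) (X : measurableType d)
    (R : realType) (mu : set X -> \bar R) (p q : R) :
    set_system (SL_space mu p q) :=
  [set G | forall f, G f -> SL_U f G].

Section SL_topology.
Context (d : measure_display) (X : measurableType d) (R : realType).
Context (mu : set X -> \bar R) (p q : R).

Let SL_openT : SL_open (setT : set (SL_space mu p q)).
Proof. by move=> f _; exists 1. Qed.

Let SL_openI : setI_closed (@SL_open d X R mu p q).
Proof.
move=> A B oA oB f [Af Bf].
have [r r0 rA] := oA f Af; have [s s0 sB] := oB f Bf.
exists (Order.min r s); first by rewrite lt_min r0.
move=> g; rewrite /SL_sphere /= EFin_min lt_min => /andP[gr gs].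
by split; [exact: rA|exact: sB].
Qed.

Let SL_open_bigU (I : Type) (F : I -> set (SL_space mu p q)) :
  (forall i, SL_open (F i)) -> SL_open (\bigcup_i F i).
Proof.
move=> oF f [i _ Fif]; have [r r0 rF] := oF i f Fif.
by exists r => // g /rF Fig; exists i.
Qed.

(* The library's [open] on [SL_space] is [SL_open], and [nbhs f] consists of
   the sets containing an open set that contains [f]. *)
HB.instance Definition _ :=
  isOpenTopological.Build (SL_space mu p q) SL_openT SL_openI SL_open_bigU.

End SL_topology.

Definition first_countable (T : topologicalType) : Prop :=
  forall x : T, exists B : set (set T),
    [/\ countable B, B `<=` nbhs x &
        forall U, nbhs x U -> exists2 V, B V & V `<=` U].

(* Main.v *)
Require Import Defs.
From mathcomp Require Import all_boot all_order all_algebra.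
From mathcomp Require Import all_classical all_reals all_analysis.
From mathcomp Require Import measurable_realfun.

Set Implicit Arguments.
Unset Strict Implicit.
Unset Printing Implicit Defensive.

Import Order.TTheory GRing.Theory Num.Theory.
Import numFieldNormedType.Exports.

(** The prenorm is never computed.  What matters is that it compares with a
    number through level sets: with k = (p/q)^(1/q), the prenorm of f is < r
    exactly when, at some height 0 <= u < r, the set {k|f| > u} has measure
    < r^p; and it is > r exactly when, at some height u > r, that set has
    measure > r^p ([SL_prenorm_ltP], [SL_prenorm_gtP]).  The exponent q survives
    only in the constant k.

    Autocontinuity is likewise used through an epsilon-delta form: if
    mu A < y, then mu (A `|` B) < y for every B of sufficiently small measure,
    and dually mu (A `\` B) > y if mu A > y
    ([autocontinuous_from_aboveP], [autocontinuous_from_belowP]).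

    From autocontinuity to topology.  The triangle inequality gives
    {k|f-h| > u+w} inside {k|f-g| > u} `|` {k|g-h| > w}.  If g is in S(f,r),
    witnessed at a height u < r, and h is very close to g, then the second set
    is small already at a height w < r-u, so autocontinuity from above keeps
    the measure of the union below r^p and h is in S(f,r).  If g is outside the
    closed sphere, witnessed at u > r, the same inclusion says that
    {k|f-h| > u-w} contains {k|f-g| > u} `\` {k|g-h| > w}, and autocontinuity
    from below keeps h outside.

    From topology to autocontinuity.  Multiples of indicators turn sets into
    points of the space: the functions of height c/k on A and on A `|` B
    (resp. A `\` B) differ only on a part of B, hence are close when mu B is
    small, while their position relative to a sphere centred at 0 depends only
    on the measures of these sets.  A sphere whose radius r satisfies r^p = y
    therefore transports the inequality from A to A `|` B (resp. A `\` B).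

    Once spheres are open they form a base of neighbourhoods, and the radii
    1/(n+1) suffice. *)

Local Open Scope classical_set_scope.
Local Open Scope ring_scope.

(** * Extended real numbers *)

Section extended_reals.
Context {R : realType}.
Implicit Types x y l : \bar R.
Local Open Scope ereal_scope.

Lemma lte_poweR2 (a : R) x y : (0 < a)%R -> 0 <= x -> 0 <= y ->
  (x `^ a < y `^ a) = (x < y).
Proof.
move=> a0 x0 y0; rewrite !ltNge; congr (~~ _); apply/idP/idP => [|yx].
  have in0y z (b : R) : z `^ b \in `[0, +oo] by rewrite in_itv/= poweR_ge0 leey.
  have a'0 : (0 <= a^-1)%R by rewrite invr_ge0 ltW.
  move/(gt0_ler_poweR a'0 (in0y _ _) (in0y _ _)).
  by rewrite /= -!poweRrM mulfV ?gt_eqF// !poweRe1.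
by apply: gt0_ler_poweR; rewrite ?in_itv/= ?leey ?x0 ?y0// ltW.
Qed.

(** Real test values [y] are enough, also when the limit is infinite: the
    neighbourhoods of an infinite point are generated by real half-lines. *)
Lemma cvge_lt_gt (u : (\bar R)^nat) l :
  (forall y : R, y%:E < l -> \forall n \near \oo, y%:E < u n) ->
  (forall y : R, l < y%:E -> \forall n \near \oo, u n < y%:E) ->
  u n @[n --> \oo] --> l.
Proof.
case: l => [r| |] lo hi A.
- move=> rA; have /nbhs_ballP[e /= e0 eA] : nbhs r (fun z => A z%:E) by [].
  have lor : \forall n \near \oo, (r - e)%:E < u n.
    by apply: lo; rewrite lte_fin ltrBlDr ltrDl.
  have hir : \forall n \near \oo, u n < (r + e)%:E.
    by apply: hi; rewrite lte_fin ltrDl.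
  apply: filterS (filterI lor hir) => n /=; case: (u n) => [s||] [].
  + by rewrite !lte_fin => ls hs; apply: eA; rewrite /ball/= ltr_distlC ls.
  + by move=> _ /lt_geF; rewrite leey.
  + by move=> /lt_geF; rewrite leNye.
- move=> [M [_ MA]]; have := lo M (ltry _).
  by apply: filterS => n /MA.
- move=> [M [_ MA]]; have := hi M (ltNyr _).
  by apply: filterS => n /MA.
Qed.

Lemma lte_posreal_between (y : R) x : y%:E < x -> 0 < x ->
  exists z : R, [/\ (0 < z)%R, (y <= z)%R & z%:E < x].
Proof.
case: x => [x||//]; last first.
  move=> _ _; exists (Num.max y 1%R).
  by rewrite lt_max ltr01 orbT le_max lexx ltry.
rewrite !lte_fin => yx x0.
have m0 : (Num.max y 0 < x)%R by rewrite gt_max yx.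
exists ((Num.max y 0 + x) / 2)%R; split.
- by rewrite divr_gt0// ltr_wpDl// le_max lexx orbT.
- by apply: le_trans (ltW (midf_lt m0).1); rewrite le_max lexx.
- exact: (midf_lt m0).2.
Qed.

End extended_reals.

(** * Comparing a Sugeno integral with a number *)

Section Sugeno_integral.
Context {X : Type} {R : realType}.
Implicit Types (mu : set X -> \bar R) (f : X -> R).
Local Open Scope ereal_scope.

Lemma Sugeno_ge0 mu f : (forall A, 0 <= mu A) -> 0 <= Sugeno mu f.
Proof.
move=> mu0; apply: ereal_sup_ubound; exists 0%R => //=.
by apply/min_idPl; exact: mu0.
Qed.

(** A height [t] cuts the supremum in two: the terms at heights at most [t] are
    bounded by [t], and the later ones by the measure of the level set at [t],
    because level sets decrease.  Conversely any height strictly between the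
    integral and [s] works, its own term being smaller than the height. *)
Lemma Sugeno_ltP mu f (s : R) : (0 < s)%R ->
  (forall t t' : R, (t <= t')%R ->
    mu [set x | (t' < f x)%R] <= mu [set x | (t < f x)%R]) ->
  Sugeno mu f < s%:E <->
  exists t : R, [/\ (0 <= t)%R, (t < s)%R & mu [set x | (t < f x)%R] < s%:E].
Proof.
move=> s0 mono; split=> [Ss|[t [t0 ts mus]]]; last first.
  rewrite /Sugeno.
  apply: (@le_lt_trans _ _ (maxe t%:E (mu [set x | (t < f x)%R]))); last first.
    by rewrite gt_max lte_fin ts.
  apply: ge_ereal_sup => _ [t' /= t'0 <-].
  have [t't|tt'] := leP t' t.
    by rewrite ge_min le_max lee_fin t't.
  by rewrite ge_min !le_max (mono _ _ (ltW tt')) !orbT.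
(* The maximum with 0 makes the chosen height nonnegative without assuming
   that the integral is. *)
have S0 : 0 <= maxe 0 (Sugeno mu f) by rewrite le_max lexx.
have Ms : maxe 0 (Sugeno mu f) < s%:E by rewrite gt_max lte_fin s0.
have [z [z0 Mz zs]] : exists z : R,
    [/\ (0 < z)%R, maxe 0 (Sugeno mu f) < z%:E & z%:E < s%:E].
  move: S0 Ms; case: (maxe 0 (Sugeno mu f)) => [m||]//.
  rewrite lee_fin !lte_fin => m0 ms.
  exists ((m + s) / 2)%R; rewrite divr_gt0 ?ltr_wpDl// !lte_fin.
  by split => //; [exact: (midf_lt ms).1|exact: (midf_lt ms).2].
exists z; split=> //; first exact: ltW.
have : mine z%:E (mu [set x | (z < f x)%R]) < z%:E.
  apply: le_lt_trans (_ : _ <= Sugeno mu f) _.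
    by apply: ereal_sup_ubound; exists z => //=; exact: ltW.
  by apply: le_lt_trans Mz; rewrite le_max lexx orbT.
by rewrite gt_min ltxx/= => /lt_trans; exact.
Qed.

Lemma Sugeno_gtP mu f (s : R) : (0 <= s)%R ->
  s%:E < Sugeno mu f <->
  exists2 t : R, (s < t)%R & s%:E < mu [set x | (t < f x)%R].
Proof.
move=> s0; split=> [/ereal_sup_gt[_ [t /= t0 <-]]|[t st smu]].
  by rewrite lt_min lte_fin => /andP[st smu]; exists t.
apply: (@lt_le_trans _ _ (mine t%:E (mu [set x | (t < f x)%R]))).
  by rewrite lt_min lte_fin st.
by apply: ereal_sup_ubound; exists t => //=; exact: le_trans s0 (ltW st).
Qed.

End Sugeno_integral.

(** * Epsilon-delta forms of autocontinuity *)

Section autocontinuity.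
Context {d : measure_display} {X : measurableType d} {R : realType}.
Variable mu : set X -> \bar R.
Hypothesis hmu : nonadditive_measure mu.
Local Open Scope ereal_scope.

Lemma nonadditive_ge0 A : measurable A -> 0 <= mu A.
Proof. by case: hmu => + _ _; exact. Qed.

Lemma nonadditive_set0 : mu set0 = 0.
Proof. by case: hmu. Qed.

Lemma le_nonadditive A B : measurable A -> measurable B -> A `<=` B ->
  mu A <= mu B.
Proof. by case: hmu => _ _; exact. Qed.

(** If no [e] works, a set of measure < 1/(n+1) violating [P] is chosen for each
    n, and these sets form a sequence of vanishing measures along which [P]
    always fails. *)
Lemma eventually_small_measureP (P : set (set X)) :
  (forall B : (set X)^nat, (forall n, measurable (B n)) ->
    mu (B n) @[n --> \oo] --> 0 -> \forall n \near \oo, P (B n)) <->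
  exists2 e : R, (0 < e)%R &
    forall B, measurable B -> mu B < e%:E -> P B.
Proof.
split=> [nearP|[e e0 eP] B mB B0]; last first.
  have : \forall n \near \oo, mu (B n) < e%:E.
    by apply: (B0 [set z | z < e%:E]); apply: open_ereal_lt'; rewrite lte_fin.
  by apply: filterS => n; exact: eP.
apply: contrapT => noe.
have /choice[B badB] : forall n : nat, exists B,
    [/\ measurable B, mu B < n.+1%:R^-1%:E & ~ P B].
  move=> n; apply: contrapT => allP; apply: noe.
  exists n.+1%:R^-1%R => // B mB Bn; apply: contrapT => PB.
  by apply: allP; exists B.
have mB n : measurable (B n) by case: (badB n).
have [] : \forall n \near \oo, P (B n); last first.
  by move=> N _ /(_ N (leqnn N)); case: (badB N).
apply: nearP => //; apply: cvge_lt_gt => y y0.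
  by apply: nearW => n; exact: lt_le_trans y0 (nonadditive_ge0 (mB n)).
rewrite lte_fin in y0.
apply: filterS (near_infty_natSinv_lt (PosNum y0)) => n /= yn.
by case: (badB n) => _ /lt_trans + _; apply; rewrite lte_fin.
Qed.

(** Only the upper estimate carries information: by monotonicity, mu (A `|` B n)
    never drops below mu A. *)
Lemma autocontinuous_from_aboveP :
  autocontinuous_from_above mu <->
  forall (A : set X) (y : R), measurable A -> mu A < y%:E ->
    exists2 e : R, (0 < e)%R &
      forall B, measurable B -> mu B < e%:E -> mu (A `|` B) < y%:E.
Proof.
split=> [above A y mA Ay|above A B mA mB B0].
  apply/(eventually_small_measureP (fun B => mu (A `|` B) < y%:E)) => B mB B0.
  by apply: (above A B mA mB B0 [set z | z < y%:E]); exact: open_ereal_lt'.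
apply: cvge_lt_gt => y yA.
  apply: nearW => n; apply: lt_le_trans yA _.
  by apply: le_nonadditive => //; exact: measurableU.
by apply: (eventually_small_measureP (fun B => mu (A `|` B) < y%:E)).2 => //;
  exact: above.
Qed.

(** Thresholds are restricted to [0 < y] because they will be p-th powers of
    radii of spheres; a nonpositive threshold below mu A can be raised to a
    positive one, unless mu A = 0, when the limit is trivial. *)
Lemma autocontinuous_from_belowP :
  autocontinuous_from_below mu <->
  forall (A : set X) (y : R), measurable A -> (0 < y)%R -> y%:E < mu A ->
    exists2 e : R, (0 < e)%R &
      forall B, measurable B -> mu B < e%:E -> y%:E < mu (A `\` B).
Proof.
split=> [below A y mA _ Ay|below A B mA mB B0].
  apply/(eventually_small_measureP (fun B => y%:E < mu (A `\` B))) => B mB B0.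
  by apply: (below A B mA mB B0 [set z | y%:E < z]); exact: open_ereal_gt'.
have leA n : mu (A `\` B n) <= mu A.
  by apply: le_nonadditive => //; exact: measurableD.
apply: cvge_lt_gt => y yA; last first.
  by apply: nearW => n; exact: le_lt_trans (leA n) yA.
have [A0|A0] := leP (mu A) 0.
  apply: nearW => n; apply: lt_le_trans yA (le_trans A0 _).
  by apply: nonadditive_ge0; exact: measurableD.
have [z [z0 yz zA]] := lte_posreal_between yA A0.
have : \forall n \near \oo, z%:E < mu (A `\` B n).
  by apply: (eventually_small_measureP (fun B => z%:E < mu (A `\` B))).2 => //;
    exact: below.
by apply: filterS => n; apply: le_lt_trans; rewrite lee_fin.
Qed.

End autocontinuity.

(** * Comparing the prenorm with a number *)

Section Sugeno_Lorentz.
Context {d : measure_display} {X : measurableType d} {R : realType}.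
Variables (mu : set X -> \bar R) (p q : R).
Hypotheses (hmu : nonadditive_measure mu) (hp : 0 < p) (hq : 0 < q).
Implicit Types f g h : {mfun X >-> R}.

(** The constant for which p a^q / q = (SL_scale a)^q, so that the integrand of
    the prenorm is a plain q-th power. *)
Definition SL_scale : R := (p / q) `^ q^-1.

(** Heights are measured after rescaling, hence in the same unit as the radii
    of the spheres. *)
Definition SL_level (u : R) (f : {mfun X >-> R}) : set X :=
  [set x | u < SL_scale * `|f x|].

Lemma SL_scale_gt0 : 0 < SL_scale.
Proof. by rewrite powR_gt0// divr_gt0. Qed.

Lemma SL_scaled_power (a : R) : 0 <= a ->
  p * a `^ q / q = (SL_scale * a) `^ q.
Proof.
move=> a0; rewrite powRM// ?(ltW SL_scale_gt0)// -powRrM mulVf ?gt_eqF//.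
by rewrite powRr1 1?mulrAC// ltW// divr_gt0.
Qed.

Lemma measurable_SL_level u f : measurable (SL_level u f).
Proof.
have mf : measurable_fun setT (fun x => SL_scale * `|f x|).
  by apply: measurable_funM => //; exact: measurableT_comp.
rewrite (_ : SL_level u f =
  setT `&` (fun x => SL_scale * `|f x|) @^-1` `]u, +oo[).
  exact: mf.
by rewrite setTI; apply/seteqP; split=> x; rewrite /SL_level/= in_itv/= andbT.
Qed.

Lemma SL_level_triangle u v f g h :
  SL_level (u + v) (f - h) `<=` SL_level u (f - g) `|` SL_level v (g - h).
Proof.
move=> x; rewrite /SL_level/= => uvfh; apply: contrapT => /not_orP[].
move=> /negP; rewrite -leNgt => fgu /negP; rewrite -leNgt => ghv.
move: uvfh; apply/negP; rewrite -leNgt; apply: le_trans (lerD fgu ghv).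
by rewrite -mulrDr ler_pM2l ?SL_scale_gt0// ler_distD.
Qed.

Lemma SL_levelBC u f g : SL_level u (f - g) = SL_level u (g - f).
Proof. by apply/seteqP; split=> x; rewrite /SL_level/= distrC. Qed.

Lemma SL_powered_level (s : R) f : 0 <= s ->
  [set x | s `^ q < p * `|f x| `^ q / q] = SL_level s f.
Proof.
move=> s0; apply/seteqP; split=> x; rewrite /SL_level/= SL_scaled_power//.
  move=> /(gt0_ltr_powR (_ : 0 < q^-1)); rewrite -!powRrM mulfV ?gt_eqF//.
  rewrite !powRr1 ?mulr_ge0// ?(ltW SL_scale_gt0)//; apply=> //;
   by rewrite ?invr_gt0 ?nnegrE ?powR_ge0.
by apply: gt0_ltr_powR; rewrite ?nnegrE ?mulr_ge0 ?(ltW SL_scale_gt0).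
Qed.

Lemma powR_surj_ge0 (t : R) : 0 <= t -> exists2 s : R, 0 <= s & t = s `^ q.
Proof.
move=> t0; exists (t `^ q^-1); first exact: powR_ge0.
by rewrite -powRrM mulVf ?gt_eqF ?powRr1.
Qed.

Lemma SL_measure_power_lt (A : set X) (r : R) : measurable A -> 0 < r ->
  (mu A `^ (q / p) < (r `^ q)%:E)%E = (mu A < (r `^ p)%:E)%E.
Proof.
move=> mA r0.
rewrite -[in RHS](@lte_poweR2 _ (q / p)) ?divr_gt0 ?nonadditive_ge0//.
  by rewrite poweR_EFin -powRrM mulrCA divff ?mulr1// gt_eqF.
by rewrite lee_fin powR_ge0.
Qed.

Lemma SL_measure_power_gt (A : set X) (r : R) : measurable A -> 0 < r ->
  ((r `^ q)%:E < mu A `^ (q / p))%E = ((r `^ p)%:E < mu A)%E.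
Proof.
move=> mA r0.
rewrite -[in RHS](@lte_poweR2 _ (q / p)) ?divr_gt0 ?nonadditive_ge0//.
  by rewrite poweR_EFin -powRrM mulrCA divff ?mulr1// gt_eqF.
by rewrite lee_fin powR_ge0.
Qed.

(** Both comparisons raised to the power q; the pair is meant for rewriting. *)
Lemma SL_prenormE_powR (r : R) : 0 < r ->
  forall f, ((SL_prenorm mu p q f < r%:E)%E =
    (Sugeno (fun A => mu A `^ (q / p)) (fun x => (p * (`|f x| `^ q) / q)%R)
      < (r `^ q)%:E)%E) *
  ((r%:E < SL_prenorm mu p q f)%E =
    ((r `^ q)%:E <
    Sugeno (fun A => mu A `^ (q / p)) (fun x => (p * (`|f x| `^ q) / q)%R))%E).
Proof.
move=> r0 f; set S := Sugeno _ _.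
have S0 : (0 <= S)%E by apply: Sugeno_ge0 => A; exact: poweR_ge0.
have rq0 : (0 <= (r `^ q)%:E)%E by rewrite lee_fin powR_ge0.
have rE : r%:E = ((r `^ q)%:E `^ q^-1)%E.
  by rewrite poweR_EFin -powRrM mulfV ?gt_eqF// powRr1// ltW.
by rewrite rE /SL_prenorm !lte_poweR2 ?invr_gt0 -?rE.
Qed.

(** The height t of the Sugeno integral and the height u of the level set
    correspond through t = u^q, and the measure threshold r^q for the power q/p
    of mu becomes r^p for mu itself. *)
Lemma SL_prenorm_ltP (r : R) f : 0 < r ->
  (SL_prenorm mu p q f < r%:E)%E <->
  exists u, [/\ 0 <= u, u < r & (mu (SL_level u f) < (r `^ p)%:E)%E].
Proof.
move=> r0; have rq0 : 0 < r `^ q by exact: powR_gt0.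
have mpow t : measurable [set x | t < p * `|f x| `^ q / q].
  (* A negative height is not a q-th power, but its level set is everything. *)
  have [t0|t0] := ltP t 0.
    rewrite (_ : [set x | _] = setT)//; apply/seteqP; split=> x //= _.
    by rewrite (lt_le_trans t0)// divr_ge0 ?mulr_ge0 ?powR_ge0 ?(ltW hp) ?(ltW hq).
  have [s s0 ->] := powR_surj_ge0 t0.
  by rewrite SL_powered_level//; exact: measurable_SL_level.
rewrite (SL_prenormE_powR r0); apply: iff_trans (Sugeno_ltP _ _) _ => //.
  move=> t t' tt'.
  apply: gt0_ler_poweR; rewrite ?in_itv/= ?leey ?andbT ?nonadditive_ge0 ?divr_ge0//;
    try exact: ltW.
  apply: le_nonadditive => // x /=; exact: le_lt_trans.
split=> [[t [t0 tr mut]]|[u [u0 ur muu]]].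
  have [s s0 tE] := powR_surj_ge0 t0; exists s; split=> //.
    move: tr; rewrite tE !ltNge; apply: contra => rs.
    by apply: ge0_ler_powR; rewrite ?nnegrE// ltW.
  move: mut; rewrite tE SL_powered_level// SL_measure_power_lt//.
  exact: measurable_SL_level.
exists (u `^ q); split; first exact: powR_ge0.
  by apply: gt0_ltr_powR; rewrite ?nnegrE// ltW.
by rewrite SL_powered_level// SL_measure_power_lt//; exact: measurable_SL_level.
Qed.

Lemma SL_prenorm_gtP (r : R) f : 0 < r ->
  (r%:E < SL_prenorm mu p q f)%E <->
  exists2 u, r < u & ((r `^ p)%:E < mu (SL_level u f))%E.
Proof.
move=> r0; rewrite (SL_prenormE_powR r0).
apply: iff_trans (Sugeno_gtP _ _ (powR_ge0 _ _)) _.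
split=> [[t rt mut]|[u ru muu]].
  have t0 : 0 <= t by rewrite (le_trans (powR_ge0 _ _) (ltW rt)).
  have [s s0 tE] := powR_surj_ge0 t0; exists s.
    move: rt; rewrite tE !ltNge; apply: contra => rs.
    by apply: ge0_ler_powR; rewrite ?nnegrE// ltW.
  move: mut; rewrite tE SL_powered_level// SL_measure_power_gt//.
  exact: measurable_SL_level.
have u0 : 0 <= u by rewrite ltW// (lt_trans r0).
exists (u `^ q); first by apply: gt0_ltr_powR; rewrite ?nnegrE// ltW.
by rewrite SL_powered_level// SL_measure_power_gt//; exact: measurable_SL_level.
Qed.

(** * Indicators as points of the space *)

Lemma Sugeno_indicator_lty (A : set X) (a : R) :
  (Sugeno mu (fun x => `|\1_A x * a|%R) < +oo)%E.
Proof.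
apply: (@le_lt_trans _ _ (`|a|)%:E); last exact: ltry.
apply: ge_ereal_sup => _ [t /= t0 <-]; rewrite ge_min lee_fin.
have [//|at'] := leP t `|a|.
rewrite (_ : [set x | _] = set0) ?(nonadditive_set0 hmu) ?lee_fin ?normr_ge0 ?orbT//.
apply/seteqP; split=> x //=; rewrite normrM indicE; apply/negP; rewrite -leNgt.
apply: le_trans (ltW at'); rewrite -[leRHS]mul1r ler_wpM2r//.
by case: (x \in A); rewrite ?normr1 ?normr0.
Qed.

(** The height is [c] after rescaling: the level sets are [A] at the heights
    below [c] and empty from [c] on. *)
Definition SL_indicator (c : R) (A : set X) (mA : measurable A) :
    SL_space mu p q :=
  exist _ (scale_mfun (c / SL_scale) (indic_mfun A mA))
    (Sugeno_indicator_lty A (c / SL_scale)).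

Lemma SL_level_indicatorE (c u : R) (A B : set X) (mA : measurable A)
    (mB : measurable B) : 0 <= c ->
  SL_level u (val (SL_indicator c mA) - val (SL_indicator c mB)) =
  [set x | u < c * ((x \in A) != (x \in B))%:R].
Proof.
move=> c0; apply/funext => x; congr (is_true (u < _)).
rewrite [LHS](_ : _ =
  SL_scale * `|\1_A x * (c / SL_scale) - \1_B x * (c / SL_scale)|)//.
rewrite !indicE -mulrBl normrM (_ : `|c / _| = c / SL_scale); last first.
  by rewrite ger0_norm// divr_ge0// ltW// SL_scale_gt0.
rewrite mulrCA (mulrC SL_scale) divfK ?(lt0r_neq0 SL_scale_gt0)//.
rewrite mulrC.
congr (_ * _); case: (x \in A); case: (x \in B);
  by rewrite ?subrr ?subr0 ?sub0r ?normrN ?normr1 ?normr0.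
Qed.

Lemma SL_level_indicator_sub (c u : R) (A B : set X) (mA : measurable A)
    (mB : measurable B) : 0 <= c -> 0 <= u ->
  SL_level u (val (SL_indicator c mA) - val (SL_indicator c mB)) `<=`
  (A `\` B) `|` (B `\` A).
Proof.
move=> c0 u0 x; rewrite SL_level_indicatorE//=.
have [xA|xA] := boolP (x \in A); have [xB|xB] := boolP (x \in B) => /=.
- by rewrite mulr0 ltNge u0.
- by move=> _; left; split; [exact: set_mem|move/mem_set; exact/negP].
- by move=> _; right; split; [exact: set_mem|move/mem_set; exact/negP].
- by rewrite mulr0 ltNge u0.
Qed.

Lemma SL_level_indicator (c u : R) (A B : set X) (mA : measurable A)
    (mB : measurable B) : 0 <= u < c ->
  SL_level u (val (SL_indicator c mA) - val (SL_indicator c mB)) =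
  (A `\` B) `|` (B `\` A).
Proof.
move=> /andP[u0 uc]; have c0 := le_trans u0 (ltW uc).
apply/seteqP; split; first exact: SL_level_indicator_sub.
move=> x; rewrite SL_level_indicatorE//=.
by move=> [[xA xB]|[xB xA]];
  [rewrite (mem_set xA) (memNset xB)|rewrite (mem_set xB) (memNset xA)];
  rewrite mulr1.
Qed.

(** * Spheres and autocontinuity *)

Lemma open_SL_spaceE (G : set (SL_space mu p q)) : open G = SL_open G.
Proof. by []. Qed.

(** Closeness in the prenorm forces a small level set at a small height, with
    independent bounds [e] on the measure and [v] on the height. *)
Lemma SL_sphere_small_level (g : SL_space mu p q) (e v : R) : 0 < e -> 0 < v ->
  exists2 r : R, 0 < r & forall h : SL_space mu p q, SL_sphere g r h ->
    exists w : R, [/\ 0 <= w, w < v & (mu (SL_level w (val g - val h)%R) < e%:E)%E].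
Proof.
move=> e0 v0; have ep0 : 0 < e `^ p^-1 by exact: powR_gt0.
have m0 : 0 < Num.min (e `^ p^-1) v by rewrite lt_min ep0.
exists (Num.min (e `^ p^-1) v) => // h /(SL_prenorm_ltP _ m0)[w [w0 wm mugh]].
exists w; split=> //; first by move: wm; rewrite lt_min => /andP[].
apply: lt_le_trans mugh _; rewrite lee_fin -[leRHS]powRr1 ?(ltW e0)//.
rewrite -[in leRHS](mulVf (lt0r_neq0 hp)) powRrM.
by apply: ge0_ler_powR; rewrite ?nnegrE ?(ltW hp) ?powR_ge0 ?(ltW m0)// ge_min lexx.
Qed.

Lemma small_level_SL_sphere (g : SL_space mu p q) (r : R) : 0 < r ->
  exists2 e : R, 0 < e & forall (h : SL_space mu p q) (w : R), 0 <= w < r ->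
    (mu (SL_level w (val g - val h)%R) < e%:E)%E -> SL_sphere g r h.
Proof.
move=> r0; exists (r `^ p); first exact: powR_gt0.
move=> h w /andP[w0 wr] muw; apply/(SL_prenorm_ltP _ r0).
by exists w.
Qed.

(** The height [u < r] at which g is seen to be in the sphere leaves room r - u,
    and the strict inequality for the measure leaves room for autocontinuity;
    both are spent on the passage from g to h. *)
Lemma autocontinuous_above_open_sphere : autocontinuous_from_above mu ->
  forall (f : SL_space mu p q) (r : R), 0 < r -> open (SL_sphere f r).
Proof.
move=> /(autocontinuous_from_aboveP hmu) above f r r0.
rewrite open_SL_spaceE => g.
rewrite /SL_sphere/= => /(SL_prenorm_ltP _ r0)[u [u0 ur mu_fg]].
have [e e0 eP] := above _ _ (measurable_SL_level _ _) mu_fg.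
have [|s s0 sP] := @SL_sphere_small_level g e (r - u) e0.
  by rewrite subr_gt0.
exists s => // h /sP[w [w0 wru mu_gh]].
apply/(SL_prenorm_ltP _ r0); exists (u + w).
split; [exact: addr_ge0|by rewrite -ltrBrDl|].
apply: le_lt_trans (eP _ (measurable_SL_level _ _) mu_gh).
apply: le_nonadditive => //; [exact: measurable_SL_level| |].
  by apply: measurableU; exact: measurable_SL_level.
exact: SL_level_triangle.
Qed.

(** Indicators of height exactly [r], the radius: every height [u < r] then sees
    the whole set, so that belonging to the sphere about 0 amounts to having
    measure < r^p = y. *)
Lemma open_sphere_autocontinuous_above :
  (forall (f : SL_space mu p q) (r : R), 0 < r -> open (SL_sphere f r)) ->
  autocontinuous_from_above mu.
Proof.
move=> osphere; apply/(autocontinuous_from_aboveP hmu) => A y mA Ay.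
have y0 : 0 < y.
  by rewrite -lte_fin; exact: le_lt_trans (nonadditive_ge0 hmu mA) Ay.
pose r := y `^ p^-1; have r0 : 0 < r by exact: powR_gt0.
have rp : r `^ p = y by rewrite -powRrM mulVf ?gt_eqF// powRr1// ltW.
(* The zero function, as an indicator. *)
pose z := SL_indicator r (@measurable0 _ X).
have : SL_sphere z r (SL_indicator r mA).
  apply/(SL_prenorm_ltP _ r0); exists 0; split=> //.
  by rewrite SL_level_indicator ?lexx ?r0// set0D setD0 set0U rp.
have := osphere z r r0; rewrite open_SL_spaceE => /[apply] -[s s0 sP].
have [e e0 eP] := small_level_SL_sphere (SL_indicator r mA) s0.
exists e => // B mB Be.
have mAB : measurable (A `|` B) by exact: measurableU.
have : SL_sphere z r (SL_indicator r mAB).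
  apply: sP; apply: (eP _ 0); first by rewrite lexx s0.
  apply: le_lt_trans Be; apply: le_nonadditive => //.
    exact: measurable_SL_level.
  apply: subset_trans (SL_level_indicator_sub (ltW r0) (lexx _)) _.
  by move=> x [[Ax []]|[[]//]]; left.
move=> /(SL_prenorm_ltP _ r0)[u [u0 ur]].
by rewrite SL_level_indicator ?u0 ?ur// set0D setD0 set0U rp.
Qed.

(** The complement is open: a height [u > r] witnesses that g is outside, and
    u - r is the room for the passage from g to h. *)
Lemma autocontinuous_below_closed_sphere : autocontinuous_from_below mu ->
  forall (f : SL_space mu p q) (r : R), 0 < r -> closed (SL_closed_sphere f r).
Proof.
move=> /(autocontinuous_from_belowP hmu) below f r r0.
rewrite -openC open_SL_spaceE => g.
rewrite /SL_closed_sphere/= => /negP; rewrite -ltNge.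
move=> /(SL_prenorm_gtP _ r0)[u ru mu_fg].
have [e e0 eP] := below _ _ (measurable_SL_level _ _) (powR_gt0 _ r0) mu_fg.
have [|s s0 sP] := @SL_sphere_small_level g e (u - r) e0.
  by rewrite subr_gt0.
exists s => // h /sP[w [w0 wur mu_gh]].
apply/negP; rewrite -ltNge.
apply/(SL_prenorm_gtP _ r0); exists (u - w); first by rewrite ltrBrDl -ltrBrDr.
apply: lt_le_trans (eP _ (measurable_SL_level _ _) mu_gh) _.
apply: le_nonadditive => //; [|exact: measurable_SL_level|].
  by apply: measurableD; exact: measurable_SL_level.
rewrite (SL_levelBC w) => x []; rewrite -{1}(subrK w u).
by move=> /SL_level_triangle-/(_ (val h))[].
Qed.

(** Here the indicators must be higher than the radius, so that some height
    strictly above [r] still sees the whole set. *)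
Lemma closed_sphere_autocontinuous_below :
  (forall (f : SL_space mu p q) (r : R), 0 < r ->
    closed (SL_closed_sphere f r)) ->
  autocontinuous_from_below mu.
Proof.
move=> csphere; apply/(autocontinuous_from_belowP hmu) => A y mA y0 yA.
pose r := y `^ p^-1; have r0 : 0 < r by exact: powR_gt0.
have rp : r `^ p = y by rewrite -powRrM mulVf ?gt_eqF// powRr1// ltW.
(* The indicators have height r + 2, and r + 1 is the witnessing height. *)
pose c := r + 1 + 1; have c0 : 0 <= c by rewrite !addr_ge0// ltW.
pose z := SL_indicator c (@measurable0 _ X).
have zA : (~` SL_closed_sphere z r) (SL_indicator c mA).
  apply/negP; rewrite -ltNge; apply/(SL_prenorm_gtP _ r0).
  exists (r + 1); first by rewrite ltrDl.
  rewrite SL_level_indicator ?set0D ?setD0 ?set0U ?rp//.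
  by rewrite /c ltrDl ltr01 andbT addr_ge0// ltW.
have := csphere z r r0; rewrite -openC open_SL_spaceE => /(_ _ zA)[s s0 sP].
have [e e0 eP] := small_level_SL_sphere (SL_indicator c mA) s0.
exists e => // B mB Be.
have mAB : measurable (A `\` B) by exact: measurableD.
have /sP : SL_sphere (SL_indicator c mA) s (SL_indicator c mAB).
  apply: (eP _ 0); first by rewrite lexx s0.
  apply: le_lt_trans Be; apply: le_nonadditive => //.
    exact: measurable_SL_level.
  apply: subset_trans (SL_level_indicator_sub c0 (lexx _)) _.
  move=> x [[Ax ABx]|[[Ax _] nAx//]].
  by apply: contrapT => Bx; exact: ABx.
move=> /negP; rewrite -ltNge => /(SL_prenorm_gtP _ r0)[u ru].
rewrite rp => /lt_le_trans; apply; apply: le_nonadditive => //.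
  exact: measurable_SL_level.
apply: subset_trans (SL_level_indicator_sub c0 _) _.
  exact: le_trans (ltW r0) (ltW ru).
by rewrite set0D setD0 set0U.
Qed.

(** * Neighbourhoods and countability *)

Lemma SL_sphere_center (f : SL_space mu p q) (r : R) : 0 < r -> SL_sphere f r f.
Proof.
move=> r0; apply/(SL_prenorm_ltP _ r0); exists 0; split=> //.
rewrite subrr (_ : SL_level 0 0 = set0) ?(nonadditive_set0 hmu) ?lte_fin ?powR_gt0//.
by apply/seteqP; split=> x //; rewrite /SL_level/= normr0 mulr0 ltxx.
Qed.

Lemma nbhs_SL_U : (forall (f : SL_space mu p q) (r : R), 0 < r ->
    open (SL_sphere f r)) ->
  forall f : SL_space mu p q, nbhs f = SL_U f.
Proof.
move=> osphere f; apply/seteqP; split=> U.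
  rewrite nbhsE => -[G [oG Gf] GU].
  move: oG; rewrite open_SL_spaceE => /(_ f Gf)[r r0 rG].
  by exists r => //; exact: subset_trans GU.
move=> [r r0 rU]; rewrite nbhsE; exists (SL_sphere f r) => //.
by split; [exact: osphere|exact: SL_sphere_center].
Qed.

Lemma SL_first_countable :
  (forall f : SL_space mu p q, nbhs f = SL_U f) ->
  first_countable (SL_space mu p q).
Proof.
move=> nbhsU f; exists (range (fun n : nat => SL_sphere f n.+1%:R^-1)); split.
- exact: sub_countable (card_image_le _ _) (countableP _).
- by move=> _ [n _ <-]; rewrite nbhsU; exists n.+1%:R^-1.
- move=> U; rewrite nbhsU => -[r r0 rU].
  have [N _ /(_ N (leqnn N))/= Nr] := near_infty_natSinv_lt (PosNum r0).
  exists (SL_sphere f N.+1%:R^-1); first by exists N.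
  move=> h; rewrite /SL_sphere/= => hN; apply: rU.
  by apply: lt_trans hN _; rewrite lte_fin.
Qed.

End Sugeno_Lorentz.

(** * The equivalences *)

Theorem theorem4p4 (d : measure_display) (X : measurableType d) (R : realType)
    (hX : [set: X] !=set0) (mu : set X -> \bar R)
    (hmu : nonadditive_measure mu) (p q : R) (hp : 0 < p) (hq : 0 < q) :
  [/\ autocontinuous_from_above mu <->
        (forall (f : SL_space mu p q) (r : R), 0 < r -> open (SL_sphere f r)),
      autocontinuous_from_above mu ->
        (forall f : SL_space mu p q, nbhs f = SL_U f) /\
        first_countable (SL_space mu p q) &
      autocontinuous_from_below mu <->
        (forall (f : SL_space mu p q) (r : R), 0 < r ->
           closed (SL_closed_sphere f r))].
Proof.
split.
- split; first exact: autocontinuous_above_open_sphere.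
  exact: open_sphere_autocontinuous_above.
- move=> above.
  have osphere := autocontinuous_above_open_sphere hmu hp hq above.
  have nbhsU := nbhs_SL_U hmu hp hq osphere.
  by split=> //; exact: SL_first_countable.
- split; first exact: autocontinuous_below_closed_sphere.
  exact: closed_sphere_autocontinuous_below.
Qed.
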